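(* Let $\varphi:K\to K$ be the Kasner map and let $A_0=\begin{pmatrix}0&1&1\\1&0&1\\1&1&0\end{pmatrix}$. Then $\varphi$ is chaotic in the sense of Devaney as well as in the sense of Li-Yorke. Moreover, $\varphi$ is a factor of the subshift of finite type $\sigma_{A_0}$, and its topological entropy is $\log 2$.
   Context: Kasner circle: $K=\{(\Sigma_+,\Sigma_-)\in\mathbb{R}^2:\Sigma_+^2+\Sigma_-^2=1\}$, with points written by their polar angle $\theta$ (mod $2\pi$). Let $T_1,T_2,T_3\in K$ be the points with angles $\pi/3$, $5\pi/3$, $\pi$ respectively. Let $\Lambda_1=\{\theta\in[0,\pi/3]\cup[5\pi/3,2\pi]\}$, $\Lambda_2=\{\theta\in[\pi,5\pi/3]\}$, $\Lambda_3=\{\theta\in[\pi/3,\pi]\}$ be the three closed arcs they determine, and let $Q_1=(2,0)$, $Q_2=(-1,-\sqrt3)$, $Q_3=(-1,\sqrt3)$. The Kasner map $\varphi:K\to K$ is defined by $\varphi(T_i)=T_i$ for $i=1,2,3$ and, for $x$ in $\Lambda_i$ not an endpoint of $\Lambda_i$, $\varphi(x)$ is the other intersection point with $K$ of the straight line through $x$ and $Q_i$ (it lies on the longer of the two arcs of $K$ with the same endpoints as $\Lambda_i$). $\Sigma_{A_0}^+=\Sigma_3^+(A_0)$ is the space of one-sided sequences $(\alpha_n)_{n\ge0}$ in $\{1,2,3\}$ with $(A_0)_{\alpha_n\alpha_{n+1}}=1$ for all $n$, with the topology induced by the product topology, and $\sigma_{A_0}$ is the left shift on it. A system $(X_2,T_2)$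 is a factor of $(X_1,T_1)$ if there is a continuous surjection $h:X_1\to X_2$ with $h\circ T_1=T_2\circ h$. A continuous map $f$ on a compact metric space $(X,d)$ is chaotic in the sense of Devaney if it is topologically transitive, its periodic points are dense in $X$, and it has sensitive dependence on initial conditions. It is chaotic in the sense of Li-Yorke if there is an uncountable set $S\subset X$ such that for any distinct $x,y\in S$, $\liminf_{n\to\infty}d(f^n(x),f^n(y))=0$ and $\limsup_{n\to\infty}d(f^n(x),f^n(y))>0$. *)

(* Defs.v *)
From HB Require Import structures.
From mathcomp Require Import all_boot all_order all_algebra finmap.
From mathcomp Require Import all_classical all_reals all_analysis.
From mathcomp Require Import ring lra.

Set Implicit Arguments.
Unset Strict Implicit.
Unset Printing Implicit Defensive.

Import Order.TTheory GRing.Theory Num.Theory.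
Import numFieldTopology.Exports.

Local Open Scope classical_set_scope.
Local Open Scope ring_scope.

Section dynamics.
Context {R : realType} {X : metricType R}.
Implicit Types (f : X -> X) (n : nat) (e : R).

Definition topologically_transitive f :=
  forall U V : set X, open U -> open V -> U !=set0 -> V !=set0 ->
    exists2 n, (0 < n)%N & (iter n f @` U) `&` V !=set0.

Definition periodic_points f : set X :=
  [set x | exists2 n, (0 < n)%N & iter n f x = x].

Definition sensitive_dependence f :=
  exists2 d : R, 0 < d & forall (x : X) (N : set X), nbhs x N ->
    exists y n, N y /\ d < mdist (iter n f x) (iter n f y).

Definition devaney_chaotic f :=
  [/\ compact [set: X] /\ continuous f,
      topologically_transitive f,
      dense (periodic_points f)
    & sensitive_dependence f].

Definition li_yorke_chaotic f :=
  [/\ compact [set: X], continuous f &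
  exists2 S : set X, ~ countable S & forall x y, S x -> S y -> x <> y ->
    limn_einf (fun n => (mdist (iter n f x) (iter n f y))%:E) = 0%E /\
    (0 < limn_esup (fun n => (mdist (iter n f x) (iter n f y))%:E))%E].

(* Bowen's definition by (n, e)-separated sets; the limsup below increases as
   e decreases, so the limit as e tends to 0 from above exists. *)

Definition separated f n e (E : {fset X}) :=
  forall x y, x \in E -> y \in E -> x <> y ->
    exists2 k, (k < n)%N & e < mdist (iter k f x) (iter k f y).

Definition max_separated f n e : \bar R :=
  ereal_sup [set (#|` E|%:R)%:E | E in separated f n e].

Definition topological_entropy f : \bar R :=
  lim (limn_esup (fun n => (n%:R^-1)%:E * lne (max_separated f n e))%E
         @[e --> (0 : R)^'+]).

End dynamics.

Definition is_factor (X1 X2 : topologicalType)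
    (T1 : X1 -> X1) (T2 : X2 -> X2) :=
  exists h : X1 -> X2,
    [/\ continuous h, range h = [set: X2] & h \o T1 = T2 \o h].

Section subshift.
Context {m : nat} (A : 'M[nat]_m).

(* [set_type] carries the subspace topology, here of the product topology on
   sequences over the discrete alphabet. *)
Definition admissible :
    set (prod_topology (fun _ : nat => discrete_topology 'I_m)) :=
  [set a | forall n, A (a n) (a n.+1) = 1%N].

Definition sft := set_type admissible.

HB.instance Definition _ := Topological.on sft.

Lemma shift_subproof (a : sft) :
  (fun n => set_val a n.+1) \in admissible.
Proof. by apply/mem_set => n; exact: (set_valP a n.+1). Qed.

Definition sft_shift (a : sft) : sft := exist _ (fun n => set_val a n.+1) (shift_subproof a).

End subshift.

(* The symbols 1, 2, 3 are the elements 0, 1, 2 of ['I_3]; the same shift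
   applies to the indices of tangency points, arcs and centres below. *)
Definition A0 : 'M[nat]_3 :=
  \matrix_(i, j) nth 0%N (nth [::] [:: [:: 0; 1; 1];
                                       [:: 1; 0; 1];
                                       [:: 1; 1; 0]]%N i) j.

Section circle.
Context (R : realType).

(* The metric put on this type is the Euclidean distance, not the one derived
   from the sup-norm balls of [R * R]. *)
Definition kasner_circle := {p : R * R | p.1 ^+ 2 + p.2 ^+ 2 == 1}.

HB.instance Definition _ := Choice.on kasner_circle.

Definition euclidean_dist (p q : R * R) : R :=
  Num.sqrt ((p.1 - q.1) ^+ 2 + (p.2 - q.2) ^+ 2).

Let dist (x y : kasner_circle) := euclidean_dist (val x) (val y).

Let distxx x : dist x x = 0.
Proof. by rewrite /dist /euclidean_dist !subrr expr0n/= addr0 sqrtr0. Qed.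

Let dist_positivity x y : dist x y = 0 -> x = y.
Proof.
move/eqP; rewrite /dist /euclidean_dist sqrtr_eq0 => h.
have {}h : (((val x).1 - (val y).1) ^+ 2 + ((val x).2 - (val y).2) ^+ 2) == 0.
  by rewrite eq_le h/= addr_ge0// sqr_ge0.
apply/val_inj; move: h; rewrite paddr_eq0 ?sqr_ge0// !sqrf_eq0 !subr_eq0.
by case: (val x) (val y) => [a b] [c d]/= /andP[/eqP-> /eqP->].
Qed.

Let dist_sym x y : dist x y = dist y x.
Proof.
by rewrite /dist /euclidean_dist -[in LHS]sqrrN opprB -[X in _ + X]sqrrN opprB.
Qed.

Let dist_triangle y x z : dist x z <= dist x y + dist y z.
Proof.
rewrite /dist /euclidean_dist.
case: (val x) (val y) (val z) => [x1 x2] [y1 y2] [z1 z2] /=.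
set a := x1 - y1; set b := x2 - y2; set c := y1 - z1; set d := y2 - z2.
have -> : x1 - z1 = a + c by rewrite /a /c; ring.
have -> : x2 - z2 = b + d by rewrite /b /d; ring.
have ab0 : 0 <= a ^+ 2 + b ^+ 2 by rewrite addr_ge0// sqr_ge0.
have cd0 : 0 <= c ^+ 2 + d ^+ 2 by rewrite addr_ge0// sqr_ge0.
rewrite -[leRHS]ger0_norm ?addr_ge0 ?sqrtr_ge0// -sqrtr_sqr ler_wsqrtr//.
rewrite [leRHS]sqrrD !sqr_sqrtr// -sqrtrM//.
suff : a * c + b * d <=
    Num.sqrt ((a ^+ 2 + b ^+ 2) * (c ^+ 2 + d ^+ 2)).
  move: (Num.sqrt _) => s; nra.
apply: (le_trans (ler_norm _)); rewrite -sqrtr_sqr ler_wsqrtr//.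
have := sqr_ge0 (a * d - b * c); nra.
Qed.

HB.instance Definition _ := isMetric.Build R kasner_circle
  distxx dist_positivity dist_sym dist_triangle.

Lemma polar_subproof (t : R) : (cos t, sin t).1 ^+ 2 + (cos t, sin t).2 ^+ 2 == 1.
Proof. by rewrite /= cos2Dsin2. Qed.

Definition polar (t : R) : kasner_circle := exist _ (cos t, sin t) (polar_subproof t).

Definition kasner_T (i : 'I_3) : kasner_circle :=
  polar (nth 0 [:: pi / 3; 5 * pi / 3; pi] i).

Definition kasner_arc (i : 'I_3) : set kasner_circle :=
  polar @` nth set0 [:: `[0, pi / 3] `|` `[5 * pi / 3, 2 * pi];
                        `[pi, 5 * pi / 3];
                        `[pi / 3, pi]]%classic i.

Definition kasner_Q (i : 'I_3) : R * R :=
  nth (0, 0) [:: (2, 0); (-1, - Num.sqrt 3); (-1, Num.sqrt 3)] i.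

Definition line (p q : R * R) : set (R * R) :=
  [set r | exists t : R, r = (p.1 + t * (q.1 - p.1), p.2 + t * (q.2 - p.2))].

(* A point that is not one of the [kasner_T] lies on exactly one arc, and then
   the set below is a singleton, so the default value of [xget] is not used. *)
Definition kasner_map (x : kasner_circle) : kasner_circle :=
  if `[< exists i, x = kasner_T i >] then x
  else xget x [set y | y <> x /\ exists2 i, kasner_arc i x &
                         line (val x) (kasner_Q i) (val y)].

End circle.

(* Main.v *)
Require Import Defs.
From mathcomp Require Import all_boot all_order all_algebra.
From mathcomp Require Import all_classical all_reals all_analysis.
From mathcomp Require Import finmap ring lra zify.

(** The line joining a point [x] of the circle [K] to [Q i] meets [K] again at
the image of [x] under the inversion of centre [Q i] and squared radius
[|Q i|^2 - 1 = 3]: the circle of this inversion is orthogonal to [K]. So the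
Kasner map is, on each arc, the restriction of an involution of [K] given by a
rational formula ([kasner_map_inversion]), and it multiplies distances there
by [3 / (|x - Q i| |y - Q i|)] ([inversion_mdist]). The arc [i] is
[{x | 1 <= x . Q i}], that is [|x - Q i|^2 <= 3]. Hence the map does not
decrease distances on an arc, and two distinct points of arc [i] keep their
distance only when both are its ends. The ends are fixed and no other arc
contains both, so the expansion is strict for points of arc [i] whose images
share another arc ([inversion_expand]). The three arcs thus form a Markov
cover with transition matrix [A0] ([kasner_markov]).

The neutral fixed points rule out uniform expansion, and compactness replaces
it: the pairs of points that can visit the same arcs forever form a compact
forward-invariant set, and a pair of distinct points at maximal distance in it
would be sent to a pair at larger distance. So this set is the diagonal and
the sets of points with a common itinerary of length [n] shrink uniformly
([follows_shrink]).

- Every admissible sequence therefore codes exactly one point, which depends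
  continuously on the sequence: this is the factor map ([factor_of_sft]).
- As the square of [A0] has positive entries, some iterate maps a given
  nonempty open set onto the whole circle ([markov_onto]). Transitivity and
  sensitivity follow. Points coded by periodic sequences are dense.
- The ends of arc 0 are coded by 0,2,0,2,... and 0,1,0,1,..., and the words 02
  and 01 may be concatenated freely. Sequences with longer and longer runs of
  each word code a Li-Yorke scrambled set ([li_yorke_of_fixpoints]).
- A separated set has at most as many points as there are admissible words of
  the right length, a constant times [2^n] ([max_separated_upper]). Conversely
  every point has two preimages more than 1/2 apart, so the [n]-th preimages
  of a point form a separated set of size [2^n]
  ([max_separated_ge_preimages]). The growth rate is then [ln 2]. *)

Set Implicit Arguments.
Unset Strict Implicit.
Unset Printing Implicit Defensive.

Import Order.TTheory GRing.Theory Num.Theory.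
Import numFieldNormedType.Exports.

Local Open Scope classical_set_scope.
Local Open Scope ring_scope.

(** * Compactness and continuity *)

Lemma compact_nested (T : topologicalType) (F : nat -> set T) :
  compact [set: T] -> (forall n, closed (F n)) ->
  (forall n, F n.+1 `<=` F n) -> (forall n, F n !=set0) ->
  exists x, forall n, F n x.
Proof.
move=> cT Fcl Fdec F0; have [u uF] := choice F0.
have Fle n k : (n <= k)%N -> F k `<=` F n.
  elim: k => [|k IHk]; first by rewrite leqn0 => /eqP ->.
  rewrite leq_eqVlt => /predU1P[->//|nk]; exact: subset_trans (Fdec k) (IHk nk).
have [|x [_ xcl]] := cT (u @ \oo) _; first exact: filterT.
exists x => n; apply: Fcl => V Vx; apply: (xcl (F n) V) => //.
by exists n => // k /= nk; exact: Fle nk _ (uF k).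
Qed.

Lemma continuous_mdist (R : realType) (X : metricType R) :
  continuous (fun p : X * X => mdist p.1 p.2 : R).
Proof.
move=> [x y]; apply/cvgrPdist_lt => e e0 /=; near=> p.
have : mdist x p.1 < e / 2 /\ mdist y p.2 < e / 2.
  near: p; exists (ball x (e / 2), ball y (e / 2)) => /=.
    by split; apply: nbhsx_ballx; rewrite divr_gt0.
  by move=> q /=; rewrite !ballEmdist.
have t1 := metric_triangle x p.1 y; have t2 := metric_triangle p.1 p.2 y.
have t3 := metric_triangle p.1 x p.2; have t4 := metric_triangle x y p.2.
rewrite (metric_sym p.2 y) in t2; rewrite (metric_sym p.1 x) in t3.
move=> [dx dy]; rewrite ltr_norml; apply/andP; split; lra.
Unshelve. all: by end_near. Qed.

(** Pieces that do not contain [x] are closed, hence absent near [x]: a point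
    near [x] shares with [x] every piece containing it. *)
Lemma continuous_lipschitz_cover (R : realType) (X : metricType R)
    (f : X -> X) (m : nat) (L : 'I_m -> set X) (M : R) : 0 < M ->
  (forall i, closed (L i)) -> (forall x, exists i, L i x) ->
  (forall i x y, L i x -> L i y -> mdist (f x) (f y) <= M * mdist x y) ->
  continuous f.
Proof.
move=> M0 Lcl Lcov Llip x.
apply/metricType_numDomainType.cvgrPdist_lt => e e0.
have near_piece i : \forall y \near x, L i y -> L i x.
  have [ix|nix] := pselect (L i x); first by apply: nearW => y _.
  have : nbhs x (~` L i).
    by apply: open_nbhs_nbhs; split => //; exact: closed_openC.
  by apply: filterS => y ny /ny.
have near_pieces : \forall y \near x, forall i, L i y -> L i x.
  exact: filter_forall.
near=> y.
have [i iy] := Lcov y.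
have ix : L i x by move: i iy; near: y; exact: near_pieces.
have xy : mdist x y < e / M.
  near: y; apply/metricType_numDomainType.nbhs_mdistP.
  by exists (e / M) => //=; rewrite divr_gt0.
apply: le_lt_trans (Llip i x y ix iy) _.
by rewrite mulrC -ltr_pdivlMr.
Unshelve. all: by end_near. Qed.

(** * Expanding Markov covers *)

(** Expansion is required only of points whose images share a piece as well,
    and without a uniform factor: this tolerates two neutral fixed points in a
    common piece. *)
Record markov_cover (R : realType) (X : metricType R) (f : X -> X) (m : nat)
    (A : 'M[nat]_m) (L : 'I_m -> set X) : Prop := MarkovCover {
  mc_closed : forall i, closed (L i);
  mc_nonempty : forall i, L i !=set0;
  mc_cover : forall x, exists i, L i x;
  mc_next : forall i x, L i x -> exists2 j, A i j = 1%N & L j (f x);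
  mc_lift : forall i j y, A i j = 1%N -> L j y -> exists2 x, L i x & f x = y;
  mc_expand : forall i j x y, A i j = 1%N -> L i x -> L i y ->
    L j (f x) -> L j (f y) -> x <> y -> mdist x y < mdist (f x) (f y) }.

Definition follows (T : Type) (m : nat) (f : T -> T) (L : 'I_m -> set T)
    (a : nat -> 'I_m) (n : nat) (x : T) :=
  forall k, (k <= n)%N -> L (a k) (iter k f x).

Definition codes (T : Type) (m : nat) (f : T -> T) (L : 'I_m -> set T)
    (a : nat -> 'I_m) (x : T) := forall k, L (a k) (iter k f x).

Lemma nbhs_sft_prefix m (A : 'M[nat]_m) (a : sft A) n :
  \forall b \near a, forall k, (k <= n)%N -> set_val b k = set_val a k.
Proof.
have ev k : \forall b \near a, set_val b k = set_val a k.
  have kcont : {for a, continuous (fun b : sft A => proj k (set_val b))}.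
    apply: (continuous_comp (f := fun b : sft A => set_val b)).
      exact: initial_continuous.
    exact: proj_continuous.
  exact: (kcont _ (discrete_set1 _)).
elim: n => [|n IHn].
  by near=> b => k; rewrite leqn0 => /eqP ->; near: b; exact: ev.
near=> b => k; rewrite leq_eqVlt => /predU1P[->|kn].
  by near: b; exact: ev.
by move: k kn; near: b; exact: IHn.
Unshelve. all: by end_near. Qed.

Section coding.
Context {R : realType} {X : metricType R} (f : X -> X) {m : nat}
  (A : 'M[nat]_m) (L : 'I_m -> set X).
Hypothesis cX : compact [set: X].
Hypothesis fcont : continuous f.
Hypothesis mcL : markov_cover f A L.

Implicit Types (a b : nat -> 'I_m) (x y z : X).

Lemma codes_shift a x n : codes f L a x ->
  codes f L (fun k => a (n + k)%N) (iter n f x).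
Proof. by move=> ax k; rewrite -iterD addnC; exact: ax. Qed.

Lemma codes_follows a x n : codes f L a x -> follows f L a n x.
Proof. by move=> ax k _; exact: ax. Qed.

Lemma continuous_iter n : continuous (iter n f).
Proof.
elim: n => [|n IHn] x; first exact: cvg_id.
by apply: continuous_comp; [exact: IHn | exact: fcont].
Qed.

Lemma closed_follows a n : closed (follows f L a n).
Proof.
have -> : follows f L a n =
    \bigcap_(k in [set k | (k <= n)%N]) (iter k f @^-1` L (a k)).
  by apply/seteqP; split => x /= h k; exact: h.
apply: closed_bigI => k _; apply: preimage_closed; last exact: mc_closed mcL _.
by move=> x _; exact: continuous_iter.
Qed.

(** An itinerary is built step by step, the state being the current piece and
    the current point. *)
Lemma ex_admissible_codes x : exists2 a, admissible A a & codes f L a x.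
Proof.
have [i ix] := mc_cover mcL x.
have /choice[s hs] (p : 'I_m * X) : exists q, L p.1 p.2 ->
    [/\ A p.1 q.1 = 1%N, L q.1 q.2 & q.2 = f p.2].
  case: p => j y /=.
  have [/(mc_next mcL)[k jk ky]|njy] := pselect (L j y).
    by exists (k, f y).
  by exists (j, y).
have sL n : L (iter n s (i, x)).1 (iter n s (i, x)).2.
  by elim: n => [//|n IHn]; rewrite iterS; case: (hs _ IHn).
exists (fun n => (iter n s (i, x)).1) => n.
  by rewrite iterS; case: (hs _ (sL n)).
suff -> : iter n f x = (iter n s (i, x)).2 by exact: sL.
by elim: n => [//|n IHn]; rewrite !iterS IHn; case: (hs _ (sL n)).
Qed.

(** Backward induction on the itinerary: the last point [z] is lifted one step
    at a time. *)
Lemma follows_lift a n j z : (forall k, (k < n)%N -> A (a k) (a k.+1) = 1%N) ->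
  A (a n) j = 1%N -> L j z ->
  exists2 x, follows f L a n x & iter n.+1 f x = z.
Proof.
elim: n a j z => [|n IHn] a j z adm anj jz.
  have [x ax <-] := mc_lift mcL anj jz.
  by exists x => // k; rewrite leqn0 => /eqP ->.
have [y ay yz] := mc_lift mcL anj jz.
have [x xa xy] := IHn a _ y (fun k kn => adm k (leqW kn)) (adm n (ltnSn n)) ay.
exists x => [k|]; last by rewrite iterS xy.
by rewrite leq_eqVlt => /predU1P[->|/xa//]; rewrite xy.
Qed.

Lemma codes_realized a : admissible A a -> exists x, codes f L a x.
Proof.
move=> adm.
have [||n|x xa] := @compact_nested X (follows f L a) cX.
- by move=> n; exact: closed_follows.
- by move=> n x xa k kn; exact/xa/leqW.
- have [z jz] := mc_nonempty mcL (a n.+1).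
  by have [x xa _] := follows_lift (fun k _ => adm k) (adm n) jz; exists x.
- by exists x => k; exact: (xa k).
Qed.

(** Pairs of points with a common admissible itinerary of length [n.+1]
    starting at [i]. The recursion presents the set as a finite union of
    preimages, which makes it closed. *)
Fixpoint twins n i : set (X * X) :=
  if n is n'.+1 then
    (L i `*` L i) `&` \bigcup_(j in [set j | A i j = 1%N])
      ((fun p => (f p.1, f p.2)) @^-1` twins n' j)
  else L i `*` L i.

Lemma closed_twins n i : closed (twins n i).
Proof.
have closedLL j : closed (L j `*` L j).
  have -> : L j `*` L j = (fst @^-1` L j) `&` (snd @^-1` L j) by [].
  apply: closedI; apply: preimage_closed; try exact: mc_closed mcL _.
    by move=> x _; exact: cvg_fst.
  by move=> x _; exact: cvg_snd.
elim: n i => [//|n IHn] i /=; apply: closedI => //.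
apply: closed_bigcup; first exact: finite_finset.
move=> j _; apply: preimage_closed; last exact: IHn.
move=> x _; apply: cvg_pair => /=.
  by apply: (continuous_comp (f := fst)); [exact: cvg_fst | exact: fcont].
by apply: (continuous_comp (f := snd)); [exact: cvg_snd | exact: fcont].
Qed.

Lemma twins_sub n i : twins n.+1 i `<=` twins n i.
Proof.
elim: n i => [|n IHn] i p [Lp [j ij jp]]; first exact: Lp.
by split=> //; exists j => //; exact: IHn.
Qed.

Lemma follows_twins a n x y : (forall k, (k < n)%N -> A (a k) (a k.+1) = 1%N) ->
  follows f L a n x -> follows f L a n y -> twins n (a 0%N) (x, y).
Proof.
elim: n a x y => [|n IHn] a x y adm ax ay.
  by split; [exact: (ax 0%N) | exact: (ay 0%N)].
split; first by split; [exact: (ax 0%N) | exact: (ay 0%N)].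
exists (a 1%N); first exact: adm.
apply: (IHn (fun k => a k.+1)) => [k kn|k kn|k kn]; first exact: adm.
  by have := ax k.+1 kn; rewrite iterSr.
by have := ay k.+1 kn; rewrite iterSr.
Qed.

(** Otherwise compactness yields two distinct points that are twins for every
    [n]. Such pairs form a compact set mapped into itself by [f], and the
    expansion contradicts the maximality of a pair at greatest distance. *)
Lemma twins_shrink e : 0 < e ->
  exists n, forall i p, twins n i p -> mdist p.1 p.2 < e.
Proof.
move=> e0; apply: contrapT => /forallNP noN.
pose P n := \bigcup_(i in [set: 'I_m]) twins n i.
have cXX : compact [set: X * X] by rewrite -setXTT; exact: compact_setX.
have Pcl n : closed (P n).
  apply: closed_bigcup; first exact: finite_finset.
  by move=> i _; exact: closed_twins.
have Pdec n : P n.+1 `<=` P n.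
  by move=> p [i _ ip]; exists i => //; exact: twins_sub.
have [p0 p0P] : exists p, forall n, P n p /\ e <= mdist p.1 p.2.
  pose F n := P n `&` [set p | e <= mdist p.1 p.2].
  apply: (compact_nested (F := F)) => //.
  - move=> n; apply: closedI => //.
    apply: (@preimage_closed _ _ (fun p : X * X => mdist p.1 p.2)
      [set t | e <= t]).
      by move=> q _; exact: continuous_mdist.
    exact: closed_ge.
  - by move=> n p [? ?]; split => //; exact: Pdec.
  - move=> n; have /existsNP[i /existsNP[p /not_implyP[ip /negP pe]]] := noN n.
    by exists p; split; [exists i | rewrite /= leNgt].
have [[x y] /set_mem Pxy xymax] :
    exists2 c, c \in \bigcap_n P n &
      forall t, t \in \bigcap_n P n -> mdist t.1 t.2 <= mdist c.1 c.2.
  apply: compact_EVT_max; first by exists p0 => n _; case: (p0P n).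
    by apply: subclosed_compact cXX _ => //; exact: closed_bigI.
  by apply: continuous_subspaceT => q; exact: continuous_mdist.
have xye : e <= mdist x y.
  apply: le_trans (xymax p0 _); first by case: (p0P 0%N).
  by apply/mem_set => n _; case: (p0P n).
have : mdist (f x) (f y) <= mdist x y.
  apply: (xymax (f x, f y)); apply/mem_set => n _.
  by have [i _ [_ [j ij jp]]] := Pxy n.+1 Logic.I; exists j.
have [i _ [[ix iy] [j ij [jx jy]]]] := Pxy 1%N Logic.I.
rewrite leNgt (mc_expand mcL ij)// => xy; move: xye.
by rewrite xy mdistxx leNgt e0.
Qed.

Lemma follows_shrink e : 0 < e -> exists n, forall a x y,
  (forall k, (k < n)%N -> A (a k) (a k.+1) = 1%N) ->
  follows f L a n x -> follows f L a n y -> mdist x y < e.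
Proof.
move=> /twins_shrink[n nP]; exists n => a x y adm ax ay.
exact: nP (follows_twins adm ax ay).
Qed.

Lemma codes_inj a x y : admissible A a -> codes f L a x -> codes f L a y ->
  x = y.
Proof.
move=> adm ax ay; apply: mdist_positivity; apply: contrapT => /eqP xy.
have xy0 : 0 < mdist x y by rewrite lt_neqAle eq_sym xy mdist_ge0.
have [n nP] := follows_shrink xy0.
have := nP a x y (fun k _ => adm k) (codes_follows ax) (codes_follows ay).
by rewrite ltxx.
Qed.

Theorem factor_of_sft : is_factor (@sft_shift m A) f.
Proof.
have admP (a : sft A) : admissible A (set_val a) by exact: set_valP.
have /choice[h hP] (a : sft A) : exists x, codes f L (set_val a) x.
  exact: codes_realized.
exists h; split.
- move=> a.
  apply/(@metricType_numDomainType.cvgrPdist_lt _ _ _ _ (nbhs_filter a)).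
  move=> e e0.
  have [n nP] := follows_shrink e0.
  near=> b; apply: (nP (set_val a)) => [k _|k kn|k kn].
  + exact: admP.
  + exact: hP.
  + suff <- : set_val b k = set_val a k by exact: hP.
    by move: k kn; near: b; exact: nbhs_sft_prefix.
- apply/seteqP; split => // x _; have [a adm ax] := ex_admissible_codes x.
  exists (exist _ a (mem_set adm)) => //.
  apply: (codes_inj adm _ ax).
  exact: hP (exist _ a (mem_set adm)).
- apply/funext => a /=; apply: (codes_inj (admP (sft_shift a))).
    exact: hP.
  exact: (codes_shift 1 (hP a)).
Unshelve. all: by end_near. Qed.

End coding.

(** * Lower and upper limits *)

Section limits.
Context {R : realType}.

Lemma limn_einf_eq0 (u : nat -> R) : (forall n, 0 <= u n) ->
  (forall e n, 0 < e -> exists2 k, (n <= k)%N & u k < e) ->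
  limn_einf (fun n => (u n)%:E) = 0%E.
Proof.
move=> u0 usmall; rewrite limn_einf_lim.
suff -> : einfs (fun n => (u n)%:E) = fun=> 0%E by exact: lim_cst.
apply/funext => n; apply/eqP; rewrite eq_le; apply/andP; split.
  apply/lee_addgt0Pr => e e0; rewrite add0e.
  have [k nk uk] := usmall e n e0; apply: (@le_trans _ _ (u k)%:E).
    by apply: ereal_inf_lbound; exists k.
  by rewrite lee_fin ltW.
by apply: le_ereal_inf_tmp => _ [k nk <-]; rewrite lee_fin.
Qed.

Lemma limn_esup_gt0 (u : nat -> R) (c : R) : 0 < c ->
  (forall n, exists2 k, (n <= k)%N & c <= u k) ->
  (0 < limn_esup (fun n => (u n)%:E))%E.
Proof.
move=> c0 ularge; rewrite limn_esup_lim; apply: (@lt_le_trans _ _ c%:E).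
  by rewrite lte_fin.
apply: lime_ge; first exact: is_cvg_esups.
apply: nearW => n; have [k nk cuk] := ularge n.
apply: (@le_trans _ _ (u k)%:E); first by rewrite lee_fin.
by apply: ereal_sup_ubound; exists k.
Qed.

(** [n^-1 * ln (C * b^n)] is [n^-1 * ln C + ln b], so the constant is
    invisible in the limit. *)
Lemma limn_esup_growth (M : nat -> \bar R) (b C : R) : 0 < b ->
  (forall n, (b ^+ n)%:E <= M n)%E ->
  (forall n, M n <= (C * b ^+ n)%:E)%E ->
  limn_esup (fun n => (n%:R^-1)%:E * lne (M n))%E = (ln b)%:E.
Proof.
move=> b0 Mlo Mup.
have C0 : 0 < C.
  have := le_trans (Mlo 0%N) (Mup 0%N); rewrite expr0 mulr1 lee_fin; lra.
apply: (cvg_limn_einf_sup _).2.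
apply: (@squeeze_cvge _ _ _ _ (fun=> (ln b)%:E) _
  (fun n => (n%:R^-1 * ln C + ln b)%:E)).
- near=> n.
  have n0 : (0 < n)%N by near: n; exists 1%N.
  have bn0 : 0 < b ^+ n by rewrite exprn_gt0.
  have nb : (ln b)%:E = ((n%:R^-1)%:E * lne (b ^+ n)%:E)%E.
    rewrite lne_EFin// -EFinM lnXn// -[ln b *+ n]mulr_natl mulrA mulVf ?mul1r//.
    by rewrite pnatr_eq0 -lt0n.
  have bI : ((b ^+ n)%:E)%E \in `[0%E, +oo%E].
    by rewrite in_itv/= lee_fin ltW// leey.
  have MI : M n \in `[0%E, +oo%E].
    by rewrite in_itv/= leey andbT (le_trans _ (Mlo n))// lee_fin ltW.
  have CI : ((C * b ^+ n)%:E)%E \in `[0%E, +oo%E].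
    by rewrite in_itv/= lee_fin leey andbT mulr_ge0 ?ltW.
  apply/andP; split.
    rewrite nb lee_pmul2l ?lte_fin ?invr_gt0 ?ltr0n//.
    by rewrite lee_lne.
  apply: (@le_trans _ _ ((n%:R^-1)%:E * lne (C * b ^+ n)%:E)%E).
    by rewrite lee_pmul2l ?lte_fin ?invr_gt0 ?ltr0n// lee_lne.
  have -> : lne (C * b ^+ n)%:E = (ln C + ln (b ^+ n))%:E.
    by rewrite lne_EFin ?mulr_gt0// lnM ?posrE.
  rewrite EFinD muleDr// -[(ln (b ^+ n))%:E]lne_EFin// -nb.
  by rewrite -EFinM -EFinD.
- exact: cvg_cst.
- apply: cvg_EFin; first exact: nearW.
  rewrite -[X in _ --> X]add0r -[X in _ --> X + _](mul0r (ln C)).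
  apply: cvgD; last exact: cvg_cst.
  apply: cvgMr_tmp; rewrite -(cvg_shiftS (fun n => n%:R^-1 : R)).
  exact: cvg_harmonic.
Unshelve. all: by end_near. Qed.

End limits.

(** * Entropy *)

Section entropy.
Context {R : realType} {X : metricType R} (f : X -> X).

Lemma topological_entropy_growth (b d : R) : 0 < b -> 0 < d ->
  (forall e, 0 < e -> e < d -> exists C : R, forall n,
    ((b ^+ n)%:E <= max_separated f n e /\
     max_separated f n e <= (C * b ^+ n)%:E)%E) ->
  topological_entropy f = (ln b)%:E.
Proof.
move=> b0 d0 H; apply: cvg_lim => //.
apply: cvg_near_cst; near=> e.
have e0 : 0 < e by [].
have ed : e < d by [].
have [C HC] := H e e0 ed.
by apply: (limn_esup_growth (C := C)) => // n; case: (HC n).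
Unshelve. all: by end_near. Qed.

Lemma max_separated_le n (e c : R) :
  (forall E, Defs.separated f n e E -> #|` E|%:R <= c) ->
  (max_separated f n e <= c%:E)%E.
Proof.
by move=> H; apply: ge_ereal_sup => _ [E sE <-]; rewrite lee_fin; exact: H.
Qed.

Lemma max_separated_ge n (e : R) E : Defs.separated f n e E ->
  ((#|` E|%:R)%:E <= max_separated f n e)%E.
Proof. by move=> sE; apply: ereal_sup_ubound; exists E. Qed.

Fixpoint preimage_tree (g : bool -> X -> X) (x : X) n : {fset X} :=
  if n is n'.+1 then
    (g true @` preimage_tree g x n' `|` g false @` preimage_tree g x n')%fset
  else [fset x]%fset.

(** Two distinct points of the tree have the same [n]-th image. If [k] is the
    last time their orbits differ, then at time [k] they are the two preimages
    of one point, hence more than [e] apart. *)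
Lemma max_separated_ge_preimages (g : bool -> X -> X) (x : X) (e : R) n :
  0 <= e -> (forall b y, f (g b y) = y) ->
  (forall y, e < mdist (g true y) (g false y)) ->
  ((2 ^+ n)%:E <= max_separated f n e)%E.
Proof.
move=> e0 fg eg.
have ginj b : injective (g b) by move=> y z /(congr1 f); rewrite !fg.
suff [<- sE] : (#|` preimage_tree g x n|%:R = 2 ^+ n :> R) /\
    Defs.separated f n e (preimage_tree g x n) by exact: max_separated_ge.
elim: n => [|n [IHc IHs]].
  split; first by rewrite /= cardfs1.
  by move=> y z /=; rewrite !inE => /eqP -> /eqP ->.
set E := preimage_tree g x n in IHc IHs *; split=> [|y z].
  have cardg b : #|` (g b @` E)%fset| = #|` E| by rewrite card_imfset.
  have disj : (g true @` E `&` g false @` E)%fset = fset0.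
    apply/fsetP => y; rewrite !inE; apply/negP => /andP[].
    move=> /imfsetP[u /= _ ->] /imfsetP[v /= _] uv.
    have := congr1 f uv; rewrite !fg => uv'; have := eg u.
    by rewrite uv uv' mdistxx ltNge e0.
  have -> : preimage_tree g x n.+1 = (g true @` E `|` g false @` E)%fset by [].
  rewrite cardfsU disj cardfs0 subn0 !cardg natrD IHc exprS; ring.
have inE' w : w \in preimage_tree g x n.+1 ->
    exists2 b, w = g b (f w) & f w \in E.
  rewrite /= -/E !inE => /orP[] /imfsetP[u /= uE ->]; rewrite fg.
    by exists true => //; rewrite fg.
  by exists false; rewrite ?fg.
move=> /inE'[b yb yE] /inE'[c zc zE] yz.
have [fyz|fyz] := eqVneq (f y) (f z); last first.
  have [k kn ek] := IHs _ _ yE zE (elimN eqP fyz).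
  by exists k.+1; rewrite // !iterSr.
exists 0%N => //; move: yz; rewrite /= yb zc fyz.
by case: b c {yb zc} => -[] // _; rewrite ?eg// metric_sym eg.
Qed.

End entropy.

(** * Locally eventually onto maps *)

Section onto.
Context {R : realType} {X : metricType R} (f : X -> X).

Definition locally_eventually_onto :=
  forall U : set X, open U -> U !=set0 ->
    exists2 n, (0 < n)%N & iter n f @` U = [set: X].

Lemma onto_transitive : locally_eventually_onto -> topologically_transitive f.
Proof.
move=> onto U V oU oV U0 [v Vv]; have [n n0 nU] := onto U oU U0.
by exists n => //; rewrite nU setTI; exists v.
Qed.

(** Some iterate sends a neighbourhood of [x] onto a set containing [p] and
    [q], and the image of [x] cannot be close to both. *)
Lemma onto_sensitive (p q : X) : p <> q -> locally_eventually_onto ->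
  sensitive_dependence f.
Proof.
move=> /eqP pq onto; rewrite -mdist_gt0 in pq.
exists (mdist p q / 3); first by rewrite divr_gt0.
move=> x N Nx; have [||n _ nN] := onto N^°; first exact: open_interior.
  by exists x.
have [y yN yp] : (iter n f @` N^°) p by rewrite nN.
have [z zN zq] : (iter n f @` N^°) q by rewrite nN.
have [dp|dp] := ltP (mdist p q / 3) (mdist (iter n f x) p).
  by exists y, n; split; [exact: interior_subset|rewrite yp].
exists z, n; split; [exact: interior_subset|rewrite zq].
have := metric_triangle p (iter n f x) q.
by rewrite (metric_sym p (iter n f x)); lra.
Qed.

End onto.

(** * Dynamics of Markov covers *)

Section markov_dynamics.
Context {R : realType} {X : metricType R} (f : X -> X) {m : nat}
  (A : 'M[nat]_m) (L : 'I_m -> set X).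
Hypothesis cX : compact [set: X].
Hypothesis fcont : continuous f.
Hypothesis mcL : markov_cover f A L.
Hypothesis conn : forall i j, exists2 c, A i c = 1%N & A c j = 1%N.

Lemma open_ball_sub (U : set X) x : open U -> U x ->
  exists2 e : R, 0 < e & forall y, mdist x y < e -> U y.
Proof.
move=> oU Ux; have /metricType_numDomainType.nbhs_mdistP[e e0 eU] :
  nbhs x U by exact: open_nbhs_nbhs.
by exists e => // y; exact: eU.
Qed.

(** A neighbourhood of [x] contains all points with a long enough common
    itinerary [a] up to time [n]. For any [z], one letter [c] connects [a n]
    to a piece containing [z], so [z] lifts to such a point. *)
Lemma markov_onto : locally_eventually_onto f.
Proof.
move=> U oU [x Ux]; have [e e0 eU] := open_ball_sub oU Ux.
have [n nP] := follows_shrink cX fcont mcL e0.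
have [a adm ax] := ex_admissible_codes mcL x.
exists n.+2 => //; apply/seteqP; split=> // z _.
have [j jz] := mc_cover mcL z; have [c ac cj] := conn (a n) j.
have [y cy <-] := mc_lift mcL cj jz.
have [w wa <-] := follows_lift mcL (fun k _ => adm k) ac cy.
exists w => //; apply/eU/(nP a) => //; exact: codes_follows.
Qed.

(** Closing up a long itinerary of [x] with one connecting letter gives a
    periodic sequence, and the point that it codes is periodic because codes
    are unique. *)
Lemma markov_periodic_dense : dense (periodic_points f).
Proof.
move=> U [x Ux] oU; have [e e0 eU] := open_ball_sub oU Ux.
have [n nP] := follows_shrink cX fcont mcL e0.
have [a adm ax] := ex_admissible_codes mcL x.
have [c ac ca] := conn (a n) (a 0%N).
pose b k := if (k %% n.+2 <= n)%N then a (k %% n.+2)%N else c.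
have bper k : b (n.+2 + k)%N = b k by rewrite /b modnDl.
have badm : admissible A b.
  move=> k /=; rewrite /b -(addn1 k) -(modnDml k).
  have := ltn_pmod k (ltn0Sn n.+1); set r := (k %% n.+2)%N; rewrite addn1 ltnS.
  rewrite leq_eqVlt => /predU1P[->|rn]; first by rewrite modnn ltnn.
  rewrite modn_small; last by rewrite ltnS.
  rewrite -ltnS rn; move: rn; rewrite ltnS leq_eqVlt => /predU1P[->|->].
    by rewrite ltnn.
  exact: adm.
have [y yb] := codes_realized cX fcont mcL badm.
exists y; split; last first.
  exists n.+2 => //; apply: (codes_inj cX fcont mcL badm _ yb).
  by move=> k; rewrite -bper; exact: (codes_shift n.+2 yb).
apply/eU/(nP a) => [k _|k kn|k kn]; [exact: adm|exact: ax|].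
have -> : a k = b k by rewrite /b modn_small ?kn// ltnS leqW.
exact: yb.
Qed.

(** If codes agree up to [n + N], then at each time below [n] the orbits share
    [N] further letters, which puts them within [e]. *)
Lemma separated_codes_inj e : 0 < e -> exists N, forall n E,
  Defs.separated f n e E -> forall a b x y, x \in E -> y \in E ->
  admissible A a -> codes f L a x -> codes f L b y ->
  (forall k, (k < n + N)%N -> a k = b k) -> x = y.
Proof.
move=> e0; have [N NP] := follows_shrink cX fcont mcL e0.
exists N => n E sE a b x y xE yE adm ax yb ab; apply: contrapT => xy.
have [k kn] := sE _ _ xE yE xy; apply/negP; rewrite -leNgt ltW//.
apply: (NP (fun i => a (k + i)%N)) => [i _|i iN|i iN].
- by rewrite addnS; exact: adm.
- exact: (codes_shift k ax).
- by rewrite ab; [exact: (codes_shift k yb) | lia].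
Qed.

End markov_dynamics.

(** * The transition matrix of three symbols *)

Lemma A0E i j : A0 i j = 1%N <-> i != j.
Proof.
rewrite mxE; case: i j => [[|[|[|//]]] ip] [[|[|[|//]]] jp] /=; by split.
Qed.

Lemma A0_connected i j : exists2 c, A0 i c = 1%N & A0 c j = 1%N.
Proof.
suff [c ci cj] : exists2 c : 'I_3, i != c & c != j by exists c; exact/A0E.
case: i j => [[|[|[|//]]] ip] [[|[|[|//]]] jp];
  ((by exists 0) || (by exists 1) || (by exists (2 : 'I_3))).
Qed.

Lemma ordS_determines (i j k : 'I_3) : i != j -> i != k ->
  (j == ordS i) = (k == ordS i) -> j = k.
Proof.
move=> ij ik jk; apply: val_inj; move: ij ik jk.
by case: i j k => [[|[|[|//]]] ip] [[|[|[|//]]] jp] [[|[|[|//]]] kp].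
Qed.

Section two_to_one.
Context {R : realType} {X : metricType R} (f : X -> X) (L : 'I_3 -> set X).
Hypothesis cX : compact [set: X].
Hypothesis fcont : continuous f.
Hypothesis mcL : markov_cover f A0 L.

(** An admissible sequence is determined by its first symbol and, at each
    step, by which of the two allowed successors is taken. This bounds the
    number of words by [3 * 2^(n + N)]. *)
Lemma max_separated_upper e : 0 < e -> exists C : R, forall n,
  (max_separated f n e <= (C * 2 ^+ n)%:E)%E.
Proof.
move=> /(separated_codes_inj cX fcont mcL)[N NP].
have /choice[c cP] x : exists a : nat -> 'I_3, admissible A0 a /\ codes f L a x.
  by have [a ? ?] := ex_admissible_codes mcL x; exists a.
exists (3 * 2 ^+ N) => n; apply: max_separated_le => E sE.
pose g x := (c x 0%N, [tuple c x (val k).+1 == ordS (c x k) | k < n + N]).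
have ginj : {in E &, injective g}.
  move=> x y xE yE gxy; have c0 := congr1 fst gxy.
  have cS k := congr1 (fun p => tnth p.2 k) gxy.
  have [cx xc] := cP x; have [cy yc] := cP y.
  apply: (NP n E sE _ _ _ _ xE yE cx xc yc).
  elim=> [//|k IHk] kn; have eqk := IHk (ltnW kn).
  apply: (@ordS_determines (c x k)); first exact/A0E/cx.
    by rewrite eqk; exact/A0E/cy.
  by have := cS (Ordinal (ltnW kn)); rewrite /g /= !tnth_mktuple /= eqk.
have ug : uniq (map g E) by rewrite map_inj_in_uniq ?fset_uniq.
have := max_card (mem (map g E)).
rewrite (card_uniqP ug) size_map card_prod card_ord card_tuple card_bool.
by rewrite -(ler_nat R) natrM natrX exprD -mulrA [_ * 2 ^+ N]mulrC.
Qed.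

(** The bit of rank 0 is common to all sequences, so that the corresponding
    runs make all the codes agree. *)
Definition bit (s : nat -> bool) v := if v is v'.+1 then s v' else false.

Definition block (b : bool) (k : nat) : 'I_3 :=
  if odd k then if b then 2 else 1 else 0.

(** The word number [j] of the code is the two-letter [block] of a bit of [s].
    That bit is constant for [2^r <= j < 2^r.+1], and its rank is the 2-adic
    valuation of [r], so each rank is served by infinitely many arbitrarily
    long runs. *)
Definition scrambled_code (s : nat -> bool) (k : nat) : 'I_3 :=
  block (bit s (logn 2 (trunc_log 2 k./2))) k.

Lemma scrambled_code_admissible s : admissible A0 (scrambled_code s).
Proof.
move=> k; apply/A0E; rewrite /scrambled_code /block /=.
by case: (odd k) => /=; case: ifP.
Qed.

Lemma scrambled_code_run s r k : (k < 2 ^ r.+1)%N ->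
  scrambled_code s ((2 ^ r).*2 + k) = block (bit s (logn 2 r)) k.
Proof.
move=> kr; rewrite /scrambled_code /block oddD odd_double addFb.
rewrite halfD odd_double /= add0n doubleK (@trunc_log_eq _ r)//.
rewrite leq_addr /= expnS mul2n -addnn ltn_add2l ltn_half_double.
by rewrite -mul2n -expnS.
Qed.

(** Cantor's diagonal argument. *)
Lemma no_inj_bool_seq (phi : (nat -> bool) -> nat) : ~ injective phi.
Proof.
move=> inj; pose s n := `[< forall t, phi t = n -> t n = false >].
case E : (s (phi s)).
  by move: (E); move=> /asboolP /(_ s erefl); rewrite E.
move: (E) => /negbT/asboolPn; apply => t /inj ->; exact: E.
Qed.

(** At the start of the [r]-th run the orbit of the point coded by
    [scrambled_code s] is close to the fixed point [t b], where [b] is the bit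
    used in this run. For [r] odd the bit is [false] for all [s], so orbits
    come together. For [r] an odd multiple of [2^v.+1] it is [s v], so the
    orbits of sequences that differ at [v] come close to different fixed
    points. *)
Lemma li_yorke_of_fixpoints (t : bool -> X) : t true <> t false ->
  (forall b, f (t b) = t b) -> (forall b k, L (block b k) (t b)) ->
  li_yorke_chaotic f.
Proof.
move=> /eqP ttf tfix tL; rewrite -mdist_gt0 in ttf.
have /choice[x xP] s :=
  codes_realized cX fcont mcL (scrambled_code_admissible s).
have near_t e : 0 < e -> exists N, forall s r, (N <= r)%N ->
    mdist (iter (2 ^ r).*2 f (x s)) (t (bit s (logn 2 r))) < e.
  move=> /(follows_shrink cX fcont mcL)[N NP]; exists N => s r Nr.
  apply: (NP (block (bit s (logn 2 r)))) => [k _|k kN|k kN].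
  - apply/A0E; rewrite /block /=; case: (odd k) => /=; by case: (bit _ _).
  - rewrite -scrambled_code_run; first exact: (codes_shift _ (xP s)).
    have := ltn_expl r.+1 (isT : (1 < 2)%N); lia.
  - have -> : iter k f (t (bit s (logn 2 r))) = t (bit s (logn 2 r)).
      by elim: k {kN} => [//|k IHk]; rewrite iterS IHk tfix.
    exact: tL.
have big_run r : (r <= (2 ^ r).*2)%N.
  have := ltn_expl r (isT : (1 < 2)%N); lia.
have scrambled s s' : s <> s' ->
    limn_einf (fun n => (mdist (iter n f (x s)) (iter n f (x s')))%:E) = 0%E /\
    (0 < limn_esup (fun n => (mdist (iter n f (x s)) (iter n f (x s')))%:E))%E.
  move=> ss'; split.
    apply: limn_einf_eq0 => [n|e n e0]; first exact: mdist_ge0.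
    have [N NP] := near_t _ (divr_gt0 e0 (ltr0Sn _ 1)).
    pose r := (n + N).*2.+1.
    have r0 : logn 2 r = 0%N by rewrite lognE dvdn2 /r /= odd_double.
    exists (2 ^ r).*2; first by apply: leq_trans (big_run r); rewrite /r; lia.
    have Nr : (N <= r)%N by rewrite /r; lia.
    have := NP s r Nr; have := NP s' r Nr; rewrite r0 /=.
    set u := iter _ _ _; set v := iter _ _ _ => h1 h2.
    have := metric_triangle v (t false) u.
    by rewrite (metric_sym (t false) u); lra.
  have [v sv] : exists v, s v <> s' v.
    by apply: contrapT => /forallNP h; apply: ss'; apply/funext => v;
       exact: contrapT (h v).
  pose c := mdist (t true) (t false).
  apply: (@limn_esup_gt0 _ _ (c / 2)) => [|n]; first by rewrite divr_gt0.
  have [N NP] := near_t (c / 4) (divr_gt0 ttf (ltr0Sn _ 3)).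
  pose r := (2 ^ v.+1 * (n + N).*2.+1)%N.
  have rv : logn 2 r = v.+1.
    by rewrite /r lognM ?expn_gt0// pfactorK// lognE dvdn2 /= odd_double addn0.
  have rnN : (n + N <= r)%N.
    apply: (@leq_trans (n + N).*2.+1); first by lia.
    by rewrite leq_pmull// expn_gt0.
  exists (2 ^ r).*2; first by apply: leq_trans (big_run r); lia.
  have Nr : (N <= r)%N by lia.
  have := NP s r Nr; have := NP s' r Nr; rewrite rv /=.
  set u := iter _ _ _; set w := iter _ _ _.
  have cE : mdist (t (s v)) (t (s' v)) = c.
    by case: (s v) (s' v) sv => -[] //; rewrite metric_sym.
  have := metric_triangle (t (s v)) w (t (s' v)).
  have := metric_triangle w u (t (s' v)); rewrite cE.
  rewrite (metric_sym (t (s v)) w) /c; lra.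
have xinj : injective x.
  move=> s s' xx; apply: contrapT => /scrambled[_]; rewrite xx.
  rewrite ltNge => /negP; apply; rewrite limn_esup_lim.
  have -> : (fun n => (mdist (iter n f (x s')) (iter n f (x s')))%:E) =
    (fun=> 0%E) :> (nat -> \bar R) by apply/funext => n; rewrite mdistxx.
  by rewrite -limn_esup_lim (cvg_limn_einf_sup (l := 0%E)) //; exact: cvg_cst.
split=> //; exists (range x).
  move=> /countable_injP[phi phi_inj]; apply: (@no_inj_bool_seq (phi \o x)).
  move=> s s' /phi_inj/= ss'; apply/xinj/ss'; apply/mem_set.
    by exists s.
  by exists s'.
move=> _ _ [s _ <-] [s' _ <-] xx; apply: scrambled => ss'; apply: xx.
by rewrite ss'.
Qed.

End two_to_one.

(** * Inversions centred at the poles of the arcs *)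

Section kasner.
Context {R : realType}.
Local Notation K := (kasner_circle R).
Local Notation Q := (@kasner_Q R).
Local Notation phi := (@kasner_map R).
Local Notation sqrt3 := (Num.sqrt (3 : R)).
Implicit Types (x y z : K) (i j k : 'I_3).

Let sqrt3E : sqrt3 ^+ 2 = 3. Proof. by rewrite sqr_sqrtr. Qed.

Definition dot (p q : R * R) : R := p.1 * q.1 + p.2 * q.2.

Local Notation "<< i , x >>" := (dot (Q i) (val x)) (at level 0).

Lemma circleE x : dot (val x) (val x) = 1.
Proof. by case: x => p /= /eqP <-; rewrite /dot !expr2. Qed.

(** The poles form an equilateral triangle centred at the origin, so the three
    numbers [x . Q i] serve as symmetric coordinates on [K]. This relation and
    the next one reduce statements about arcs to inequalities in them. *)
Lemma dot_Q_sum i j k x : i != j -> i != k -> j != k ->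
  <<i, x>> + <<j, x>> + <<k, x>> = 0.
Proof.
rewrite /dot /kasner_Q; case: i j k =>
  [[|[|[|//]]] ip] [[|[|[|//]]] jp] [[|[|[|//]]] kp] //= _ _ _; ring.
Qed.

Lemma dot_Q_sqr_sum i j k x : i != j -> i != k -> j != k ->
  <<i, x>> ^+ 2 + <<j, x>> ^+ 2 + <<k, x>> ^+ 2 = 6.
Proof.
have := circleE x; have := sqrt3E; rewrite /dot /kasner_Q.
move: sqrt3 => s s3; case: x => [[a b] /= _] ab.
case: i j k =>
  [[|[|[|//]]] ip] [[|[|[|//]]] jp] [[|[|[|//]]] kp] //= _ _ _;
  nra.
Qed.

Lemma third_index i j : i != j -> exists2 k, i != k & j != k.
Proof.
case: i j => [[|[|[|//]]] ip] [[|[|[|//]]] jp] //= _;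
  ((by exists 0) || (by exists 1) || (by exists (2 : 'I_3))).
Qed.

Lemma dot_Q_ge1_excl i j x : i != j -> 1 <= <<i, x>> -> <<j, x>> <= 1.
Proof.
move=> ij ix; have [k ik jk] := third_index ij.
have := dot_Q_sum x ij ik jk; have := dot_Q_sqr_sum x ij ik jk.
move: (<<k, x>>) (<<i, x>>) (<<j, x>>) ix => c a b; nra.
Qed.

(** Writing [u] and [v] for [1 - x . Q j] and [1 - x . Q k], the two relations
    give [(u + v) (u + v - 3) = u v]. If [u] and [v] were positive then
    [u + v > 3], that is [x . Q i > 1]. *)
Lemma dot_Q_le1_next i x : <<i, x>> <= 1 -> exists2 j, i != j & 1 <= <<j, x>>.
Proof.
have [j ij] : exists j, i != j.
  by case: i => [[|[|[|//]]] ip]; [exists 1|exists 0|exists 0].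
have [k ik jk] := third_index ij => ix.
have [jx|jx] := leP 1 <<j, x>>; first by exists j.
exists k => //.
have := dot_Q_sum x ij ik jk; have := dot_Q_sqr_sum x ij ik jk.
move: (<<k, x>>) (<<i, x>>) (<<j, x>>) ix jx => c a b; nra.
Qed.

Lemma dot_Q_cover x : exists i, 1 <= <<i, x>>.
Proof.
have [h|h] := leP 1 <<0, x>>; first by exists 0.
by have [j _ jx] := dot_Q_le1_next (ltW h); exists j.
Qed.

Lemma Q_sqr i : dot (Q i) (Q i) = 4.
Proof.
have := sqrt3E; rewrite /dot /kasner_Q; move: sqrt3 => s s3.
case: i => [[|[|[|//]]] ip] /=; ring: s3.
Qed.

Lemma Q_dot i j : i != j -> dot (Q i) (Q j) = - 2.
Proof.
have := sqrt3E; rewrite /dot /kasner_Q; move: sqrt3 => s s3.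
case: i j => [[|[|[|//]]] ip] [[|[|[|//]]] jp] //= _; ring: s3.
Qed.

Lemma dot_Q_le2 i x : <<i, x>> <= 2.
Proof.
have := circleE x; have := Q_sqr i; rewrite /dot.
have := sqr_ge0 ((Q i).1 - 2 * (val x).1).
have := sqr_ge0 ((Q i).2 - 2 * (val x).2); nra.
Qed.

(** For [p] on [K] the denominator is [|p - Q i|^2], see [sqdist_QE]. *)
Definition inversion_pt i (p : R * R) : R * R :=
  let c := 3 / (5 - 2 * dot (Q i) p) in
  ((Q i).1 + c * (p.1 - (Q i).1), (Q i).2 + c * (p.2 - (Q i).2)).

Lemma sqdist_Q_gt0 i x : 0 < 5 - 2 * <<i, x>>.
Proof. have := dot_Q_le2 i x; lra. Qed.

Lemma sqdist_QE i x : 5 - 2 * <<i, x>> =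
  ((val x).1 - (Q i).1) ^+ 2 + ((val x).2 - (Q i).2) ^+ 2.
Proof.
have := circleE x; have := Q_sqr i; rewrite /dot.
move: (Q i) (val x) => [a b] [c d] /=; lra.
Qed.

Lemma inversion_subproof i x :
  (inversion_pt i (val x)).1 ^+ 2 + (inversion_pt i (val x)).2 ^+ 2 == 1.
Proof.
apply/eqP; rewrite /inversion_pt; set c := 3 / _.
have cD : c * (5 - 2 * <<i, x>>) = 3.
  by rewrite mulfVK// gt_eqF// sqdist_Q_gt0.
have := circleE x; have := Q_sqr i; move: c cD; rewrite /dot /=.
move: (Q i) (val x) => [a b] [d e] /= c cD Qi xx; clear i x.
have -> : (a + c * (d - a)) ^+ 2 + (b + c * (e - b)) ^+ 2 =
  (a * a + b * b) * (1 - c) ^+ 2 + 2 * (a * d + b * e) * (c - c * c)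
  + (d * d + e * e) * c ^+ 2 by ring.
rewrite Qi xx; have := congr1 (fun t => c * t) cD => /= ccD; lra.
Qed.

Definition inversion i x : K :=
  exist (fun p : R * R => p.1 ^+ 2 + p.2 ^+ 2 == 1) _ (inversion_subproof i x).

Lemma val_inversion i x : val (inversion i x) = inversion_pt i (val x).
Proof. by []. Qed.

(** The sign tells on which side of the polar line of [Q i] the image lies: the
    inversion exchanges arc [i] and the complementary arc, and fixes their
    common ends. *)
Lemma inversion_dot i x :
  <<i, inversion i x>> - 1 = 3 * (1 - <<i, x>>) / (5 - 2 * <<i, x>>).
Proof.
have D0 := sqdist_Q_gt0 i x; have -> : <<i, inversion i x>> =
    4 + 3 / (5 - 2 * <<i, x>>) * (<<i, x>> - 4).
  by rewrite -(Q_sqr i) /dot /=; ring.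
by field; rewrite gt_eqF.
Qed.

Lemma inversion_dot_neq i j x : i != j -> <<j, inversion i x>> =
  (4 * <<i, x>> + 3 * <<j, x>> - 4) / (5 - 2 * <<i, x>>).
Proof.
move=> ij; have D0 := sqdist_Q_gt0 i x; have -> : <<j, inversion i x>> =
    -2 + 3 / (5 - 2 * <<i, x>>) * (<<j, x>> - -2).
  by rewrite -(Q_dot ij) /dot /=; ring.
by field; rewrite gt_eqF.
Qed.

Lemma mdist_sqr x y : mdist x y ^+ 2 =
  ((val x).1 - (val y).1) ^+ 2 + ((val x).2 - (val y).2) ^+ 2.
Proof.
have -> : mdist x y = euclidean_dist (val x) (val y) by [].
by rewrite sqr_sqrtr// addr_ge0// sqr_ge0.
Qed.

Lemma dot_Q_mdist i j k x y : i != j -> i != k -> j != k ->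
  6 * mdist x y ^+ 2 = (<<i, x>> - <<i, y>>) ^+ 2 +
    (<<j, x>> - <<j, y>>) ^+ 2 + (<<k, x>> - <<k, y>>) ^+ 2.
Proof.
rewrite mdist_sqr; have := sqrt3E; rewrite /dot /kasner_Q.
move: sqrt3 (val x) (val y) => s [a b] [c d] s3.
have := congr1 (fun t => t * (b - d) ^+ 2) s3 => /= sbd.
case: i j k =>
  [[|[|[|//]]] ip] [[|[|[|//]]] jp] [[|[|[|//]]] kp] //= _ _ _; lra.
Qed.

Lemma inversion_mdist i x y : mdist (inversion i x) (inversion i y) ^+ 2 =
  9 * mdist x y ^+ 2 / ((5 - 2 * <<i, x>>) * (5 - 2 * <<i, y>>)).
Proof.
have := sqdist_Q_gt0 i x; have := sqdist_Q_gt0 i y.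
rewrite !mdist_sqr !val_inversion /inversion_pt !sqdist_QE.
move: (Q i) (val x) (val y) => [a b] [c d] [e g] /= N0 N0'.
by field; rewrite !gt_eqF.
Qed.

Lemma inversionK i : involutive (inversion i).
Proof.
move=> x; have D0 := sqdist_Q_gt0 i x.
have D0' := sqdist_Q_gt0 i (inversion i x).
have DD : 5 - 2 * <<i, inversion i x>> = 9 / (5 - 2 * <<i, x>>).
  have -> : <<i, inversion i x>> = 1 + 3 * (1 - <<i, x>>) / (5 - 2 * <<i, x>>).
    by rewrite -inversion_dot; ring.
  by field; rewrite gt_eqF.
apply: val_inj; rewrite val_inversion {1}/inversion_pt DD val_inversion.
rewrite /inversion_pt; move: D0 {DD D0'}; move: (dot _ _) => q D0.
case: (val x) => [a b] /=.
by congr pair; field; rewrite ?mulf_neq0 ?gt_eqF.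
Qed.

Lemma inversion_id i x : <<i, x>> = 1 -> inversion i x = x.
Proof.
move=> ix; apply: val_inj; rewrite val_inversion /inversion_pt ix.
case: (val x) => [a b] /=.
have -> : 3 / (5 - 2 * 1) = 1 :> R by field.
by congr pair; ring.
Qed.

(** * Arcs as half-plane sections of the circle *)

(** The triple angle formula turns [cos pi = -1] into
    [(c + 1) (2 c - 1)^2 = 0]. *)
Lemma cos_pi3 : cos (pi / 3 : R) = 1 / 2.
Proof.
have p0 := @pi_gt0 R.
have c0 : 0 < cos (pi / 3 : R) by apply: cos_gt0_pihalf; apply/andP; split; lra.
have : cos (pi / 3 + (pi / 3 + pi / 3) : R) = -1.
  by rewrite -cospi; congr cos; field.
rewrite !cosD sinD; have := cos2Dsin2 (pi / 3 : R).
move: (cos _) (sin _) c0 => c s c0 cs c3.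
have : (c + 1) * (2 * c - 1) ^+ 2 = 0.
  have -> : (c + 1) * (2 * c - 1) ^+ 2 = c * (c * c - (1 - c ^+ 2)) -
    2 * c * (1 - c ^+ 2) + 1 by ring.
  have <- : s ^+ 2 = 1 - c ^+ 2 by rewrite -cs; ring.
  by rewrite -[X in _ + X]opprK -c3; ring.
move=> /eqP; rewrite mulf_eq0 gt_eqF/=; last by lra.
by rewrite sqrf_eq0 => /eqP; lra.
Qed.

Lemma sin_pi3 : sin (pi / 3 : R) = sqrt3 / 2.
Proof.
have p0 := @pi_gt0 R.
have s0 : 0 < sin (pi / 3 : R) by apply: sin_gt0_pi; apply/andP; split; lra.
apply/eqP; rewrite -(@eqrXn2 _ 2)// ?ltW// ?divr_ge0// ?sqrtr_ge0//.
by rewrite expr_div_n sqr_sqrtr// sin2cos2 cos_pi3; apply/eqP; field.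
Qed.

Definition arc_center i : R := nth 0 [:: 0; 4 * pi / 3; 2 * pi / 3] i.

Lemma kasner_Q_polar i :
  Q i = (2 * cos (arc_center i), 2 * sin (arc_center i)).
Proof.
rewrite /kasner_Q /arc_center; case: i => [[|[|[|//]]] ip] /=.
- by rewrite cos0 sin0; congr pair; ring.
- have -> : 4 * pi / 3 = pi / 3 + pi :> R by field.
  by rewrite cosDpi sinDpi cos_pi3 sin_pi3; congr pair; field.
- have -> : 2 * pi / 3 = - (pi / 3) + pi :> R by field.
  by rewrite cosDpi sinDpi cosN sinN cos_pi3 sin_pi3; congr pair; field.
Qed.

Lemma dot_Q_polar i t : <<i, polar t>> = 2 * cos (t - arc_center i).
Proof. by rewrite kasner_Q_polar /dot cosB /=; ring. Qed.

Lemma cos_ge_half u : - (pi / 3) <= u <= pi / 3 -> 1 / 2 <= cos u :> R.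
Proof.
have p0 := @pi_gt0 R.
move=> /andP[ul ur].
have u3 : `|u| <= pi / 3 by rewrite ler_norml; apply/andP; split; lra.
have ui : `|u| \in `[0, pi : R].
  by rewrite in_itv/= normr_ge0/=; apply: le_trans u3 _; lra.
have ti : pi / 3 \in `[0, pi : R] by rewrite in_itv/=; apply/andP; split; lra.
by rewrite -cos_pi3 leNgt -(cos_norm u) ltr_cos// -leNgt.
Qed.

Lemma angle_of_cos_ge_half (a b : R) : a ^+ 2 + b ^+ 2 = 1 -> 1 / 2 <= a ->
  exists u, [/\ - (pi / 3) <= u <= pi / 3, cos u = a & sin u = b].
Proof.
move=> ab a2; have p0 := @pi_gt0 R.
have a1 : -1 <= a <= 1 by apply/andP; split; nra.
have ca : cos (acos a) = a by rewrite acosK// in_itv.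
have ac0 := acos_ge0 a1; have acpi := acos_lepi a1.
have ac3 : acos a <= pi / 3.
  rewrite leNgt -ltr_cos ?in_itv/= ?ac0 ?acpi//; last by apply/andP; split; lra.
  by rewrite cos_pi3 ca -leNgt.
have sa : sin (acos a) = `|b|.
  by rewrite sin_acos// -sqrtr_sqr; congr Num.sqrt; lra.
have [b0|b0] := leP 0 b.
  exists (acos a); split=> //; first by apply/andP; split; lra.
  by rewrite sa ger0_norm.
exists (- acos a); split; first by apply/andP; split; lra.
  by rewrite cosN.
by rewrite sinN sa ltr0_norm// opprK.
Qed.

Lemma polar_surj i x : 1 <= <<i, x>> ->
  exists2 u, - (pi / 3) <= u <= pi / 3 & x = polar (u + arc_center i).
Proof.
move=> ix; have := circleE x; move: ix; rewrite kasner_Q_polar /dot.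
have := cos2Dsin2 (arc_center i).
case: x => -[a b] /= ab; set c := cos _; set s := sin _ => cs ix abE.
have [||u [uI cu su]] := @angle_of_cos_ge_half (c * a + s * b) (c * b - s * a).
- have -> : (c * a + s * b) ^+ 2 + (c * b - s * a) ^+ 2 =
    (c ^+ 2 + s ^+ 2) * (a * a + b * b) by ring.
  by rewrite cs abE mulr1.
- lra.
exists u => //; apply: val_inj => /=; rewrite cosD sinD cu su -/c -/s.
by congr pair; [rewrite -[LHS]mul1r|rewrite -[LHS]mul1r]; rewrite -cs; ring.
Qed.

Lemma polarD2pi t : polar (t + 2 * pi) = polar t :> K.
Proof.
apply: val_inj => /=; have -> : t + 2 * pi = t + pi *+ 2 by ring.
by rewrite cosD2pi sinD2pi.
Qed.

(** Both sides consist of the points whose angle differs from that of [Q i] by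
    at most [pi / 3], modulo [2 * pi]. *)
Lemma kasner_arcE i : kasner_arc i = [set x | 1 <= <<i, x>>].
Proof.
have p0 := @pi_gt0 R; apply/seteqP; split => x /=.
  move=> [t ti <-]; rewrite dot_Q_polar.
  suff : 1 / 2 <= cos (t - arc_center i) by lra.
  move: ti; rewrite /arc_center; case: i => [[|[|[|//]]] ip] /=.
  + rewrite subr0 => -[] /=; rewrite in_itv /= => /andP[tl tr].
      by apply: cos_ge_half; apply/andP; split; lra.
    have -> : cos t = cos (t - 2 * pi).
      by rewrite -(cosD2pi (t - 2 * pi)); congr cos; ring.
    by apply: cos_ge_half; apply/andP; split; lra.
  + rewrite in_itv /= => /andP[tl tr].
    by apply: cos_ge_half; apply/andP; split; lra.
  + rewrite in_itv /= => /andP[tl tr].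
    by apply: cos_ge_half; apply/andP; split; lra.
move=> /polar_surj[u /andP[ul ur] ->]; rewrite /kasner_arc /arc_center.
case: i => [[|[|[|//]]] ip] /=.
+ have [u0|u0] := leP 0 u.
    exists u; last by rewrite addr0.
    by left; rewrite /= in_itv/= u0 ur.
  exists (u + 2 * pi); last by rewrite polarD2pi addr0.
  by right; rewrite /= in_itv/=; apply/andP; split; lra.
+ eexists; last reflexivity; rewrite /= in_itv/=; apply/andP; split; lra.
+ eexists; last reflexivity; rewrite /= in_itv/=; apply/andP; split; lra.
Qed.

Lemma continuous_polar : continuous (@polar R).
Proof.
move=> t; apply/metricType_numDomainType.cvgrPdist_lt => e e0.
near=> u.
have cu : `|cos t - cos u| < e / 2.
  near: u; apply: (cvgrPdist_lt _ _).1; last by rewrite divr_gt0.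
  exact: continuous_cos.
have su : `|sin t - sin u| < e / 2.
  near: u; apply: (cvgrPdist_lt _ _).1; last by rewrite divr_gt0.
  exact: continuous_sin.
rewrite -(@ltr_pXn2r _ 2)// ?nnegrE ?mdist_ge0 ?ltW// mdist_sqr /=.
move: cu su; rewrite !ltr_norml => /andP[? ?] /andP[? ?]; nra.
Unshelve. all: by end_near. Qed.

Lemma compact_kasner_arc i : compact (@kasner_arc R i).
Proof.
apply: continuous_compact; last first.
  by case: i => [[|[|[|//]]] ip] /=; rewrite ?setU_compact;
    do ?apply: compactU; exact: segment_compact.
by apply: continuous_subspaceT; exact: continuous_polar.
Qed.

Lemma closed_kasner_arc i : closed (@kasner_arc R i).
Proof.
by apply: compact_closed; [exact: metric_hausdorff | exact: compact_kasner_arc].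
Qed.

Lemma compact_kasner_circle : compact [set: K].
Proof.
have -> : [set: K] = kasner_arc 0 `|` kasner_arc 1 `|` kasner_arc (2 : 'I_3).
  apply/seteqP; split=> // x _; have [i] := dot_Q_cover x.
  case: i => [[|[|[|//]]] ip]; rewrite !kasner_arcE => ix.
  - left; left; rewrite /= (_ : 0 = Ordinal ip)//; exact: val_inj.
  - left; right; rewrite /= (_ : 1 = Ordinal ip)//; exact: val_inj.
  - right; rewrite /= (_ : 2 = Ordinal ip)//; exact: val_inj.
by do ?apply: compactU; exact: compact_kasner_arc.
Qed.

(** The end common to two arcs is antipodal to the pole of the third one. *)
Lemma kasner_TE i :
  val (@kasner_T R i) = (- (Q (ordS i)).1 / 2, - (Q (ordS i)).2 / 2).
Proof.
rewrite /kasner_T /kasner_Q; case: i => [[|[|[|//]]] ip] /=.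
- by rewrite cos_pi3 sin_pi3; congr pair; field.
- have -> : 5 * pi / 3 = - (pi / 3) + pi *+ 2 :> R by field.
  by rewrite cosD2pi sinD2pi cosN sinN cos_pi3 sin_pi3; congr pair; field.
- by rewrite cospi sinpi; congr pair; field.
Qed.

Lemma dot_Q_kasner_T i l :
  <<i, @kasner_T R l>> = if i == ordS l then -2 else 1.
Proof.
rewrite kasner_TE.
have -> : dot (Q i) (- (Q (ordS l)).1 / 2, - (Q (ordS l)).2 / 2) =
  - dot (Q i) (Q (ordS l)) / 2 by rewrite /dot /=; field.
by have [->|il] := eqVneq i; rewrite ?Q_sqr ?(Q_dot il); field.
Qed.

(** A point with [x . Q i = 1] has its two other coordinates [1] and [-2],
    since their sum is [-1] and the sum of their squares is 5. *)
Lemma kasner_TP x : (exists l, x = kasner_T R l) <-> exists i, <<i, x>> = 1.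
Proof.
split=> [[l ->]|[i ix]].
  by exists l; rewrite dot_Q_kasner_T; case: l => [[|[|[|//]]] ip].
have [j ij jx] : exists2 j, i != j & <<j, x>> = -2.
  have [j ij] : exists j, i != j.
    by case: i {ix} => [[|[|[|//]]] ip]; [exists 1|exists 0|exists 0].
  have [k ik jk] := third_index ij.
  have := dot_Q_sum x ij ik jk; have := dot_Q_sqr_sum x ij ik jk.
  rewrite ix; have [j2|j2] := eqVneq <<j, x>> (-2); first by exists j.
  move=> sq su; exists k => //; apply/eqP; rewrite -subr_eq0.
  have kE : <<k, x>> = - 1 - <<j, x>> by lra.
  have /eqP : (<<j, x>> + 2) * (<<k, x>> - -2) = 0.
    by move: sq; rewrite kE; move: <<j, x>> => p; lra.
  by rewrite mulf_eq0 => /orP[/eqP h|//]; case/eqP: j2; lra.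
have [l lj] : exists l, ordS l = j.
  by exists (ord_pred j); rewrite ord_predK.
exists l; apply: val_inj; rewrite kasner_TE lj.
have := circleE x; have := Q_sqr j; move: jx; rewrite /dot.
move: (val x) (Q j) => [a b] [c d] /= jx cc ab.
have /eqP : (a + c / 2) ^+ 2 + (b + d / 2) ^+ 2 = 0 by lra.
rewrite paddr_eq0 ?sqr_ge0// !sqrf_eq0 => /andP[/eqP ? /eqP ?].
by congr pair; lra.
Qed.

(** * The Kasner map as an expanding Markov map *)

Lemma line_inversion i x y : y <> x -> line (val x) (Q i) (val y) ->
  y = inversion i x.
Proof.
move=> yx [t yE]; have D0 := sqdist_Q_gt0 i x.
have t0 : t != 0.
  apply/eqP => t0; apply: yx; apply: val_inj; rewrite yE t0.
  by rewrite !mul0r !addr0; case: (val x).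
have tE : t = 1 - 3 / (5 - 2 * <<i, x>>).
  have : t * (t * (5 - 2 * <<i, x>>) - 2 * (1 - <<i, x>>)) = 0.
    have := circleE x; have := circleE y; have := sqdist_QE i x.
    rewrite yE; rewrite /dot /=.
    move: (val x) (Q i) => [a b] [c d] /= h1 h2 h3.
    have h4 := congr1 (fun u => t ^+ 2 * u) h1.
    have h5 := congr1 (fun u => t * u) h3; lra.
  move=> /eqP; rewrite mulf_eq0 (negbTE t0)/= subr_eq0 => /eqP tD.
  apply: (mulIf (lt0r_neq0 D0)); rewrite tD; field.
  by rewrite gt_eqF.
apply: val_inj; rewrite val_inversion yE /inversion_pt.
by move: (3 / _) tE => c ->; congr pair; ring.
Qed.

(** A point that lies on two arcs, or at the end of one, is fixed by both
    definitions. Otherwise its arc is unique, and the line through the pole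
    meets the circle in [x] and its inverse only. *)
Lemma kasner_map_inversion i x : kasner_arc i x -> phi x = inversion i x.
Proof.
rewrite kasner_arcE /= => ix; rewrite /kasner_map; case: asboolP => [|notT].
  move=> /kasner_TP[j jx]; have [ij|ij] := eqVneq i j.
    by rewrite inversion_id// ij.
  rewrite inversion_id//; apply/eqP; rewrite eq_le ix andbT.
  by apply: (dot_Q_ge1_excl (i := j)); rewrite 1?eq_sym// jx.
have lt1 j : <<j, x>> <> 1 by move=> jx; apply: notT; apply/kasner_TP; exists j.
apply: xget_unique.
  split; last first.
    exists i; first by rewrite kasner_arcE.
    exists (1 - 3 / (5 - 2 * <<i, x>>)); rewrite val_inversion /inversion_pt.
    by congr pair; ring.
  move=> xx; apply: (lt1 i); have := inversion_dot i x; rewrite xx.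
  have D0 := sqdist_Q_gt0 i x => /eqP; rewrite eq_sym -subr_eq0 => /eqP h.
  have {h} : (<<i, x>> - 1) * (8 - 2 * <<i, x>>) = 0.
    have -> : (<<i, x>> - 1) * (8 - 2 * <<i, x>>) =
       (3 * (1 - <<i, x>>) / (5 - 2 * <<i, x>>) - (<<i, x>> - 1)) *
        - (5 - 2 * <<i, x>>) by field; rewrite gt_eqF.
    by rewrite h mul0r.
  by move=> /eqP; rewrite mulf_eq0 => /orP[] /eqP; lra.
move=> y [yx [j jx yl]].
have ij : j = i.
  apply/eqP; apply: contrapT => /negP ij; apply: (lt1 i).
  apply/eqP; rewrite eq_le ix andbT; apply: (dot_Q_ge1_excl ij).
  by move: jx; rewrite kasner_arcE.
by rewrite -ij; exact: line_inversion.
Qed.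

Lemma mdist_inversion_le i x y : mdist (inversion i x) (inversion i y) <=
  3 * mdist x y.
Proof.
have Dx := dot_Q_le2 i x; have Dy := dot_Q_le2 i y.
rewrite -(@ler_pXn2r _ 2)// ?nnegrE ?mulr_ge0 ?mdist_ge0//.
rewrite inversion_mdist ler_pdivrMr; last by nra.
have DD : 0 <= (5 - 2 * <<i, x>>) * (5 - 2 * <<i, y>>) - 1 by nra.
by have := mulr_ge0 (sqr_ge0 (mdist x y)) DD; rewrite exprMn; lra.
Qed.

Lemma continuous_kasner_map : continuous phi.
Proof.
apply: (@continuous_lipschitz_cover _ _ _ _ (@kasner_arc R) 3) => //.
- exact: closed_kasner_arc.
- by move=> x; have [i ix] := dot_Q_cover x; exists i; rewrite kasner_arcE.
- move=> i x y ix iy.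
  rewrite (kasner_map_inversion ix) (kasner_map_inversion iy).
  exact: mdist_inversion_le.
Qed.

Lemma inversion_ge1 i x : <<i, x>> <= 1 -> 1 <= <<i, inversion i x>>.
Proof.
move=> ix; rewrite -subr_ge0 inversion_dot divr_ge0 ?mulr_ge0 ?subr_ge0//.
by rewrite -subr_ge0 ltW// sqdist_Q_gt0.
Qed.

Lemma inversion_le1 i x : 1 <= <<i, x>> -> <<i, inversion i x>> <= 1.
Proof.
move=> ix; rewrite -subr_le0 inversion_dot pmulr_lle0 ?invr_gt0 ?sqdist_Q_gt0//.
lra.
Qed.

(** The factor [3 / (|x - Q i| |y - Q i|)] is 1 only when [x] and [y] are both
    ends of arc [i]. They are then fixed, and lie in the same second arc [j],
    which contains a single end of arc [i]. *)
Lemma inversion_expand i j x y : i != j ->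
  1 <= <<i, x>> -> 1 <= <<i, y>> ->
  1 <= <<j, inversion i x>> -> 1 <= <<j, inversion i y>> -> x <> y ->
  mdist x y < mdist (inversion i x) (inversion i y).
Proof.
move=> ij ix iy jx jy xy.
have Dx := sqdist_Q_gt0 i x; have Dy := sqdist_Q_gt0 i y.
have d0 : 0 < mdist x y ^+ 2.
  by rewrite exprn_gt0// mdist_gt0; exact/eqP.
rewrite -(@ltr_pXn2r _ 2)// ?nnegrE ?mdist_ge0// inversion_mdist.
rewrite ltr_pdivlMr ?mulr_gt0// mulrC ltr_pM2r//.
have [ix1|ix1] := eqVneq <<i, x>> 1; last first.
  have : 1 < <<i, x>> by rewrite lt_neqAle eq_sym ix1.
  by move: <<i, x>> <<i, y>> Dx Dy iy => a b; nra.
have [iy1|iy1] := eqVneq <<i, y>> 1; last first.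
  have : 1 < <<i, y>> by rewrite lt_neqAle eq_sym iy1.
  by move: <<i, x>> <<i, y>> Dx Dy ix => a b; nra.
have [k ik jk] := third_index ij; exfalso; apply: xy; apply: mdist_positivity.
rewrite !inversion_id// in jx jy.
have jx1 : <<j, x>> = 1 by apply/eqP; rewrite eq_le jx (dot_Q_ge1_excl ij).
have jy1 : <<j, y>> = 1 by apply/eqP; rewrite eq_le jy (dot_Q_ge1_excl ij).
have sx := dot_Q_sum x ij ik jk; have sy := dot_Q_sum y ij ik jk.
have := dot_Q_mdist x y ij ik jk.
have -> : <<k, x>> = <<k, y>> by lra.
rewrite ix1 iy1 jx1 jy1 !subrr expr0n /= !addr0 => /eqP.
by rewrite mulf_eq0 sqrf_eq0 (gt_eqF (_ : 0 < 6))//= => /eqP.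
Qed.

Lemma kasner_markov : markov_cover phi A0 (@kasner_arc R).
Proof.
split.
- exact: closed_kasner_arc.
- move=> i; exists (@kasner_T R i); rewrite kasner_arcE /= dot_Q_kasner_T.
  by case: i => [[|[|[|//]]] ip].
- by move=> x; have [i ix] := dot_Q_cover x; exists i; rewrite kasner_arcE.
- move=> i x ix; rewrite (kasner_map_inversion ix).
  move: ix; rewrite kasner_arcE => /inversion_le1/dot_Q_le1_next[j ij jx].
  by exists j; [exact/A0E | rewrite kasner_arcE].
- move=> i j y /A0E ij; rewrite kasner_arcE /= => jy.
  have ji : j != i by rewrite eq_sym.
  have iy := inversion_ge1 (dot_Q_ge1_excl ji jy).
  have ay : kasner_arc i (inversion i y) by rewrite kasner_arcE.
  by exists (inversion i y) => //; rewrite (kasner_map_inversion ay) inversionK.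
- move=> i j x y /A0E ij ix iy.
  rewrite (kasner_map_inversion ix) (kasner_map_inversion iy).
  by move: ix iy; rewrite !kasner_arcE /=; exact: inversion_expand.
Qed.

(** For [y] in arc [k], the preimage [inversion i y] lies in the half of arc
    [i] away from arc [j], and symmetrically. So the dot products with [Q i]
    and with [Q j] each differ by at least 3/2 between the two preimages. *)
Lemma inversion_apart i j k y : i != j -> i != k -> j != k ->
  1 <= <<k, y>> -> 1 / 2 < mdist (inversion i y) (inversion j y).
Proof.
move=> ij ik jk ky.
have ki : k != i by rewrite eq_sym.
have kj : k != j by rewrite eq_sym.
have ji : j != i by rewrite eq_sym.
have key a b : a != b -> a != k -> b != k ->
    1 <= <<a, inversion a y>> /\ <<b, inversion a y>> <= - (1 / 2).
  move=> ab ak bk; have ka : k != a by rewrite eq_sym.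
  have kb : k != b by rewrite eq_sym.
  have Da := sqdist_Q_gt0 a y.
  have h1 := inversion_ge1 (dot_Q_ge1_excl ka ky).
  have h2 := dot_Q_ge1_excl kb ky.
  split=> //; have := dot_Q_sum (inversion a y) ab ak bk.
  have : <<b, inversion a y>> <= <<k, inversion a y>>.
    rewrite !inversion_dot_neq// ler_pM2r ?invr_gt0//; lra.
  lra.
have [ii ji'] := key i j ij ik jk; have [jj ij'] := key j i ji jk ik.
rewrite -(@ltr_pXn2r _ 2)// ?nnegrE ?mdist_ge0//.
have := dot_Q_mdist (inversion i y) (inversion j y) ij ik jk.
have := sqr_ge0 (<<k, inversion i y>> - <<k, inversion j y>>).
move: <<i, inversion i y>> <<j, inversion i y>> <<i, inversion j y>>
  <<j, inversion j y>> (mdist _ _ ^+ 2) ii ji' jj ij' => a b c d e.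
nra.
Qed.

Lemma kasner_preimages : exists g : bool -> K -> K,
  (forall b y, phi (g b y) = y) /\
  (forall y, 1 / 2 < mdist (g true y) (g false y)).
Proof.
have /choice[j jP] y : exists j, 1 <= <<j, y>> by exact: dot_Q_cover.
have ordS3 (k : 'I_3) : [/\ ordS k != ordS (ordS k), ordS k != k
    & ordS (ordS k) != k] by case: k => [[|[|[|//]]] kp].
exists (fun b y => inversion (if b then ordS (j y) else ordS (ordS (j y))) y).
split=> [b y|y]; last first.
  by have [? ? ?] := ordS3 (j y); exact: (inversion_apart (k := j y)).
set i := (if b then _ else _).
have ji : j y != i.
  by rewrite /i; have [? ? ?] := ordS3 (j y); case: b {i}; rewrite eq_sym.
have iy := inversion_ge1 (dot_Q_ge1_excl ji (jP y)).
have ay : kasner_arc i (inversion i y) by rewrite kasner_arcE.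
by rewrite (kasner_map_inversion ay) inversionK.
Qed.

Lemma kasner_T_neq : kasner_T R 0 <> kasner_T R 1.
Proof.
by move=> T01; have := dot_Q_kasner_T 1 0; rewrite T01 dot_Q_kasner_T /=; lra.
Qed.

Lemma kasner_map_T l : phi (kasner_T R l) = kasner_T R l.
Proof. by rewrite /kasner_map; case: asboolP => // -[]; exists l. Qed.

End kasner.

Theorem proposition3 (R : realType) :
  [/\ devaney_chaotic (@kasner_map R),
      li_yorke_chaotic (@kasner_map R),
      is_factor (@sft_shift 3 A0) (@kasner_map R)
    & topological_entropy (@kasner_map R) = (ln 2)%:E].
Proof.
have cK := @compact_kasner_circle R.
have cphi := @continuous_kasner_map R.
have mK := @kasner_markov R.
have onto := markov_onto cK cphi mK A0_connected.
split.
- split=> //.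
  + exact: onto_transitive.
  + exact: (markov_periodic_dense cK cphi mK A0_connected).
  + exact: onto_sensitive (@kasner_T_neq R) onto.
- apply: (li_yorke_of_fixpoints cK cphi mK
    (t := fun b : bool => if b then kasner_T R 0 else kasner_T R 1)).
  + exact: kasner_T_neq.
  + by move=> b; rewrite -fun_if kasner_map_T.
  + move=> b k; rewrite kasner_arcE /= -fun_if dot_Q_kasner_T /block.
    by case: (odd k); case: b.
- exact: (factor_of_sft cK cphi mK).
- have [g [phig gapart]] := @kasner_preimages R.
  apply: (@topological_entropy_growth _ _ _ 2 (1 / 2)) => // e e0 e2.
  have [C CP] := max_separated_upper cK cphi mK e0.
  exists C => n; split; last exact: CP.
  apply: (max_separated_ge_preimages (kasner_T R 0) n (ltW e0) phig).
  by move=> y; exact: lt_trans (gapart y).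
Qed.
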